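(* There is an absolute constant $C>0$ such that the following holds. Let $\varepsilon\in(0,1)$, $\delta\in(0,1/2]$, $n,s\in\mathbb{N}$, $k\ge2$, $\nu=\lceil n/s\rceil+1$, $\eta\ge0$, and let $W\in\mathbb{R}^{k\times\nu}$. There exists an $(\varepsilon,\delta)$-LNDP algorithm $\mathcal{A}^{W,\eta}$ such that for every graph $G$ on node set $[n]$, \[ \mathbb{E}\big[\|\mathcal{A}^{W,\eta}(G)-W\tilde f_{G,s}\|_\infty\big]\le C\Big(\eta+\gamma_\eta(W)\sqrt{\Big(\frac1n+\frac1{s^2}\Big)\log k}\cdot\frac{\sqrt{\log(1/\delta)}}{\varepsilon}\Big), \] where $\gamma_\eta(W)=\min\{\|L\|_{2\to\infty}\|R\|_{1\to2}: L\in\mathbb{R}^{k\times\ell},R\in\mathbb{R}^{\ell\times\nu},\ell\in\mathbb{N},\ \|LR-W\|_{1\to\infty}\le\eta\}$.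
   Context: Graphs are simple and undirected on node set $[n]$; $N_i^G$ is the neighborhood of node $i$ and $d_i=|N_i^G|$. Two graphs on $[n]$ are node neighbors if they differ only in edges incident to a single node. Random variables $R_1,R_2$ are $(\varepsilon,\delta)$-indistinguishable if for every event $Y$, $\Pr[R_1\in Y]\le e^\varepsilon\Pr[R_2\in Y]+\delta$ and symmetrically. An algorithm $\mathcal{A}$ on $n$-node graphs is (noninteractive) $(\varepsilon,\delta)$-LNDP if there exist a distribution over public random strings $\rho$, local randomizers $\mathcal{R}_{1,\rho},\dots,\mathcal{R}_{n,\rho}$ (with independent internal randomness), and a postprocessing $\mathcal{P}$ with $\mathcal{A}(G)=\mathcal{P}(\mathcal{R}_{1,\rho}(N_1^G),\dots,\mathcal{R}_{n,\rho}(N_n^G))$, such that for every fixed $\rho$ and every node-neighboring $G,G'$ the randomizer output vectors on $G$ and $G'$ are $(\varepsilon,\delta)$-indistinguishable. The degree distribution of $G$ is $f_G(d)=\frac1n|\{i:d_i=d\}|$, $d\in\{0,\dots,n-1\}$. For $s\in\mathbb{N}$, $R_s(x)=s(\lfloor x/s\rfloor+B)$ with $B\sim\mathrm{Bern}(x/s-\lfloor x/s\rfloor)$. The compressed blurry degree distribution $\tilde f_{G,s}$ is the law of $R_s(X)/s$ for $X\sim f_G$, viewed as a vector in $\mathbb{R}^\nu$ indexed by $0,\dots,\nu-1$. For a matrix $A$: $\|A\|_{1\to2}$ is the maximum $\ell_2$ norm of a column, $\|A\|_{2\to\infty}$ the maximum $\ell_2$ norm of a row, $\|A\|_{1\to\infty}$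 the maximum absolute entry. *)

(* Defs.v *)
From HB Require Import structures.
From mathcomp Require Import all_boot all_order all_algebra.
From mathcomp Require Import all_classical all_reals all_analysis.
Unset Strict Implicit. Unset Printing Implicit Defensive.
Import Order.TTheory GRing.Theory Num.Theory.
Local Open Scope ring_scope.
Local Open Scope classical_set_scope.

Record graph (n : nat) := Graph {
  adj : rel 'I_n ;
  adj_sym : symmetric adj ;
  adj_irr : irreflexive adj }.
Arguments adj {n}.

Definition nbhd {n} (G : graph n) (i : 'I_n) : {set 'I_n} := [set j | adj G i j].
Definition deg {n} (G : graph n) (i : 'I_n) : nat := #|nbhd G i|.

Definition node_neighbors {n} (G G' : graph n) : Prop :=
  exists v : 'I_n, forall i j : 'I_n, i != v -> j != v -> adj G i j = adj G' i j.

Section Defs.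
Context {R : realType}.

Definition indist (eps delta : R) {dO dT} {Omega : measurableType dO}
  {T : measurableType dT} (P : probability Omega R) (X1 X2 : Omega -> T) : Prop :=
  forall Y : set T, measurable Y ->
    (P (X1 @^-1` Y) <= (expR eps)%:E * P (X2 @^-1` Y) + delta%:E)%E /\
    (P (X2 @^-1` Y) <= (expR eps)%:E * P (X1 @^-1` Y) + delta%:E)%E.

Definition mutually_independent {dO dT} {Omega : measurableType dO}
  {T : measurableType dT} (P : probability Omega R) {n : nat}
  (X : 'I_n -> Omega -> T) : Prop :=
  forall A : 'I_n -> set T, (forall i, measurable (A i)) ->
    P (\bigcap_(i in [set: 'I_n]) (X i @^-1` A i)) =
    (\prod_(i < n) P (X i @^-1` A i))%E.

(* Noninteractive local algorithms on n-node graphs with output in R^k.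
   - a public random string rho drawn from Ppub on Pub;
   - local randomizers R_{i,rho}, whose internal randomness is the
     private sample omega drawn (independently of rho) from Ppriv;
     R_{i,rho}(N) = rand i rho N omega, messages in Msg;
   - a postprocessing map post from the n-tuple of messages to R^k.
   Measurability requirements make the expectation meaningful. *)
Record local_alg (n k : nat) := LocalAlg {
  pub_d : measure_display ;
  Pub : measurableType pub_d ;
  Ppub : probability Pub R ;
  priv_d : measure_display ;
  Priv : measurableType priv_d ;
  Ppriv : probability Priv R ;
  msg_d : measure_display ;
  Msg : measurableType msg_d ;
  rand : 'I_n -> Pub -> {set 'I_n} -> Priv -> Msg ;
  post : n.-tuple Msg -> 'cV[R]_k ;
  rand_meas : forall i N,
    measurable_fun [set: (Pub * Priv)%type] (fun z => rand i z.1 N z.2) ;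
  post_meas : forall j : 'I_k,
    measurable_fun [set: n.-tuple Msg] (fun t => post t j ord0) ;
  rand_indep : forall (rho : Pub) (N : 'I_n -> {set 'I_n}),
    mutually_independent Ppriv (fun i => rand i rho (N i)) }.
Arguments Pub {n k}. Arguments Priv {n k}. Arguments Msg {n k}.
Arguments Ppub {n k}. Arguments Ppriv {n k}.
Arguments rand {n k}. Arguments post {n k}.


Definition rand_out {n k} (A : local_alg n k) (G : graph n) (rho : Pub A)
  (omega : Priv A) : n.-tuple (Msg A) :=
  [tuple rand A i rho (nbhd G i) omega | i < n].

Definition alg_output {n k} (A : local_alg n k) (G : graph n) (rho : Pub A)
  (omega : Priv A) : 'cV[R]_k := post A (rand_out A G rho omega).

Definition is_LNDP (eps delta : R) {n k} (A : local_alg n k) : Prop :=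
  forall (rho : Pub A) (G G' : graph n), node_neighbors G G' ->
    indist eps delta (Ppriv A) (rand_out A G rho) (rand_out A G' rho).

Definition linf_norm {k} (v : 'cV[R]_k) : R := \big[Num.max/0]_(i < k) `|v i ord0|.
Definition norm_2_inf {m p} (A : 'M[R]_(m, p)) : R :=
  \big[Num.max/0]_(i < m) Num.sqrt (\sum_(j < p) A i j ^+ 2).
Definition norm_1_2 {m p} (A : 'M[R]_(m, p)) : R :=
  \big[Num.max/0]_(j < p) Num.sqrt (\sum_(i < m) A i j ^+ 2).
Definition norm_1_inf {m p} (A : 'M[R]_(m, p)) : R :=
  \big[Num.max/0]_(i < m) \big[Num.max/0]_(j < p) `|A i j|.

(* gamma_eta(W) : the (approximate) factorization norm, as the infimum
   (= the minimum of the paper) over all factorizations *)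
Definition gamma_eta {k nu} (eta : R) (W : 'M[R]_(k, nu)) : R :=
  inf [set x | exists (l : nat) (L : 'M[R]_(k, l)) (Rm : 'M[R]_(l, nu)),
                 norm_1_inf (L *m Rm - W) <= eta /\
                 x = norm_2_inf L * norm_1_2 Rm].

Definition deg_distr {n} (G : graph n) (d : 'I_n) : R :=
  #|[set i : 'I_n | deg G i == d]|%:R / n%:R.

Definition nu (n s : nat) : nat := (n %/ s + (n %% s != 0))%N.+1.

(* Pr[ R_s(x)/s = j ] where R_s(x)/s = floor(x/s) + B,
   B ~ Bern(x/s - floor(x/s)) *)
Definition blur_prob (s x j : nat) : R :=
  let p := (x %% s)%N%:R / s%:R in
  (if j == (x %/ s)%N then 1 - p else 0) + (if j == (x %/ s)%N.+1 then p else 0).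

(* compressed blurry degree distribution: law of R_s(X)/s, X ~ f_G,
   as a vector indexed by 0, ..., nu - 1 *)
Definition cbdd {n} (s : nat) (G : graph n) : 'cV[R]_(nu n s) :=
  \col_(j < nu n s) \sum_(d < n) deg_distr G d * blur_prob s d j.

Definition expected_error {n k} s (A : local_alg n k) (W : 'M[R]_(k, nu n s))
  (G : graph n) : \bar R :=
  (\int[Ppub A]_rho \int[Ppriv A]_omega
     (linf_norm (alg_output A G rho omega - W *m cbdd s G))%:E)%E.

End Defs.

(* Main.v *)
Require Import Defs.
From HB Require Import structures.
From mathcomp Require Import all_boot all_order all_algebra.
From mathcomp Require Import all_classical all_reals all_analysis.
From mathcomp Require Import measurable_realfun simple_functions.
From mathcomp Require Import measurable_fun_approximation ring lra.
Import Order.TTheory GRing.Theory Num.Theory.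
Local Open Scope ring_scope.
Local Open Scope classical_set_scope.

(* Fix a factorization L A close to W. Node i sends A b_i + sigma z_i, where b_i
   is the law of R_s(d_i)/s and z_i is standard Gaussian; the analyst applies L to
   the average of the messages. Rewiring one node v moves b_v by at most 2 in l1
   norm, and every other b_i by at most 2/s, since the other degrees change by at
   most 1 and x |-> b_x is piecewise linear with slope 1/s. So the squared l2
   sensitivity of the message vector is at most 4 |A|^2 (1 + n/s^2), which fixes
   sigma through the Gaussian mechanism, and averaging divides the variance of the
   noise by n. The k coordinates of the error are then Gaussians of standard
   deviation at most sigma |L| / sqrt n, and their expected maximum is bounded by
   their exponential moments.
   The factor 2 lost by choosing a near-optimal factorization requires
   gamma_eta(W) > 0; if gamma_eta(W) = 0 then every entry of W is at most eta in
   absolute value, and the constant output 0 is accurate enough. *)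

(** * Gaussian measures *)

Section density.
Local Open Scope ereal_scope.
Context d (T : measurableType d) (R : realType).
Import HBNNSimple.

(** For indicators this is the hypothesis on [m]. It passes to nonnegative simple functions by
    linearity, and to [f] by monotone convergence on both sides. *)
Lemma ge0_integral_density (mu m : {measure set T -> \bar R}) (g : T -> R) :
  measurable_fun [set: T] g -> (forall x, (0 <= g x)%R) ->
  (forall A, measurable A -> m A = \int[mu]_(x in A) (g x)%:E) ->
  forall f : T -> \bar R, measurable_fun [set: T] f -> (forall x, 0 <= f x) ->
  \int[m]_x f x = \int[mu]_x (f x * (g x)%:E).
Proof.
move=> mg g0 mE f mf f0.
pose f_ := nnsfun_approx measurableT mf.
have cf x : [set: T] x -> (EFin \o f_^~ x) @ \oo --> f x.
  by move=> ?; apply: cvg_nnsfun_approx.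
have mfn n : measurable_fun [set: T] (EFin \o f_ n).
  exact/measurable_EFinP/measurable_funP.
have mgE : measurable_fun [set: T] (EFin \o g) by exact/measurable_EFinP.
transitivity (limn (fun n => \int[m]_x (f_ n x)%:E)).
  rewrite -monotone_convergence//.
  - by apply: eq_integral => x _; apply/esym/cvg_lim => //; exact: cf.
  - by move=> n x _; rewrite lee_fin.
  - by move=> x _ i j ij; rewrite lee_fin; exact/lefP/nd_nnsfun_approx.
transitivity (limn (fun n => \int[mu]_x ((f_ n x)%:E * (g x)%:E))); last first.
  rewrite -monotone_convergence//.
  - apply: eq_integral => x _; apply/cvg_lim => //.
    by apply: cvgeZr => //; exact: cf.
  - by move=> n; apply: emeasurable_funM => //; exact: mfn.
  - by move=> n x _; rewrite mule_ge0// lee_fin.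
  - move=> x _ i j ij; rewrite lee_wpmul2r ?lee_fin//.
    exact/lefP/nd_nnsfun_approx.
congr (limn _); apply/funext => n.
have fE x : (f_ n x)%:E = \sum_(y \in range (f_ n)) (y * \1_(f_ n @^-1` [set y]) x)%:E.
  by rewrite {1}fimfunE -fsumEFin.
under eq_integral do rewrite fE.
rewrite ge0_integral_fsum//; last 2 first.
  - by move=> r; exact/measurable_EFinP/measurableT_comp.
  - by move=> r x _; rewrite EFinM nnfun_muleindic_ge0.
have fgE x : (f_ n x)%:E * (g x)%:E =
   \sum_(y \in range (f_ n)) (y * \1_(f_ n @^-1` [set y]) x)%:E * (g x)%:E.
  rewrite fE ge0_mule_fsuml// => r.
  by rewrite EFinM nnfun_muleindic_ge0.
under [in RHS]eq_integral do rewrite fgE.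
rewrite ge0_integral_fsum//; last 2 first.
  - move=> r; apply: emeasurable_funM => //.
    exact/measurable_EFinP/measurableT_comp.
  - by move=> r x _; apply: mule_ge0; [rewrite EFinM nnfun_muleindic_ge0|rewrite lee_fin].
apply: eq_fsbigr => r _.
rewrite integralZl_indic_nnsfun//= integral_indic// setIT mE//.
transitivity (\int[mu]_x (r%:E * ((g x)%:E * (\1_(f_ n @^-1` [set r]) x)%:E))); last first.
  apply: eq_integral => x _.
  by rewrite EFinM -muleA; congr (_ * _); rewrite muleC.
(* A nonnegative simple function takes no negative value, so for [r < 0] both sides vanish;
   otherwise [r] is a nonnegative constant and leaves the integral. *)
have [r0|r0] := ltP r 0%R.
  rewrite preimage_nnfun0// integral_set0 mule0 integral0_eq// => x _.
  by rewrite indicE in_set0 !mule0.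
rewrite ge0_integralZl_EFin//.
- congr (_ * _); rewrite integral_mkcond; apply: eq_integral => x _.
  rewrite patchE indicE /restrict; case: ifPn => _; by rewrite ?mule1 ?mule0.
- by move=> x _; rewrite mule_ge0 ?lee_fin.
- apply: emeasurable_funM => //; exact/measurable_EFinP.
Qed.
End density.

Section gauss1.
Local Open Scope ereal_scope.
Context {R : realType}.
Local Notation mu := (@lebesgue_measure R).

Lemma measurable_shift (c : R) :
  measurable_fun [set: measurableTypeR R] ((fun x => (x + c)%R) : _ -> measurableTypeR R).
Proof. by apply: measurable_funD => //; exact: measurable_cst. Qed.

(** Lebesgue measure is determined by its values on half-open intervals, and a translation keeps
    their length. *)
Lemma lebesgue_measure_shift (c : R) (A : set R) : measurable A ->
  pushforward mu ((fun x => (x + c)%R) : _ -> measurableTypeR R) A = mu A.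
Proof.
move=> mA.
pose m : {measure set (measurableTypeR R) -> \bar R} :=
  measure_function_pushforward__canonical__measure_function_Measure mu (measurable_shift c).
apply/esym; refine (@lebesgue_measure_unique R m _ A mA) => _ [[a b]] _ <-.
rewrite {}/m /= /pushforward.
have -> : (fun x : R => (x + c)%R) @^-1` `]a, b]%classic = `](a - c)%R, (b - c)%R]%classic :> set R.
  by apply/seteqP; split => x /=; rewrite !in_itv/= ltrBlDr lerBrDr.
rewrite !lebesgue_measure_itv/= !lte_fin ltrBlDr subrK.
by case: ifPn => // _; congr EFin; rewrite opprB addrA subrK.
Qed.

Lemma ge0_integral_lebesgue_shift (c : R) (f : R -> \bar R) :
  measurable_fun [set: R] f -> (forall x, 0 <= f x) ->
  \int[mu]_x f (x + c)%R = \int[mu]_x f x.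
Proof.
move=> mf f0; rewrite -[LHS](@ge0_integral_pushforward _ _ _ _ _ _ (measurable_shift c) mu setT)//.
apply: eq_measure_integral => [|? A mA _]; first exact: measurable_shift.
exact: lebesgue_measure_shift.
Qed.

Definition gauss : probability (measurableTypeR R) R := normal_prob 0 1.

(** The exponential is the ratio of the density of the Gaussian centred at [c] to the standard
    density: the Cameron-Martin formula in dimension one. *)
Lemma ge0_integral_gauss_shift (c : R) (f : R -> \bar R) :
  measurable_fun [set: R] f -> (forall x, 0 <= f x) ->
  \int[gauss]_x f (x + c)%R =
  \int[gauss]_x (f x * (expR (c * x - c ^+ 2 / 2))%:E).
Proof.
move=> mf f0.
have mp := measurable_normal_pdf (0 : R) 1.
have p0 := normal_pdf_ge0 (0 : R) 1.
have mh : measurable_fun [set: R] (fun x => expR (c * x - c ^+ 2 / 2)).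
  apply: measurableT_comp => //; apply: measurable_funB => //.
have mpE : measurable_fun [set: R] (EFin \o (normal_pdf (0 : R) 1)) by exact/measurable_EFinP.
have mhE : measurable_fun [set: R] (EFin \o (fun x => expR (c * x - c ^+ 2 / 2))).
  exact/measurable_EFinP.
have dens g : measurable_fun [set: R] g -> (forall x, 0 <= g x) ->
    \int[gauss]_x g x = \int[mu]_x (g x * (normal_pdf 0 1 x)%:E).
  by move=> mg g0; apply: ge0_integral_density.
rewrite dens//; last exact: measurableT_comp mf (measurable_shift c).
rewrite dens//; last 2 first.
- by apply: emeasurable_funM.
- by move=> x; rewrite mule_ge0// lee_fin expR_ge0.
(* Translating the right-hand side makes both integrands contain [f (x + c)], so that only the
   densities remain to be compared. *)
rewrite -[RHS](ge0_integral_lebesgue_shift c); last 2 first.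
- by apply: emeasurable_funM => //; exact: emeasurable_funM.
- by move=> x; rewrite !mule_ge0// lee_fin ?expR_ge0.
apply: eq_integral => x _; rewrite -muleA -EFinM; congr (_ * _%:E)%E.
rewrite !normal_pdfE ?oner_eq0// mulrCA; congr (_ * _)%R.
rewrite /normal_fun -expRD; congr expR.
by field.
Qed.

End gauss1.

(** * Finite powers of a probability measure *)

Section tuple_prob.
Local Open Scope ereal_scope.
Context {d} {T : measurableType d} {R : realType} (P : probability T R).

Definition cons_pair {n} (z : T * n.-tuple T) : n.+1.-tuple T := [tuple of z.1 :: z.2].

Lemma measurable_cons_pair n : measurable_fun [set: T * n.-tuple T] (@cons_pair n).
Proof. exact: measurable_cons measurable_fst measurable_snd. Qed.

Section step.
Context {n : nat} (Q : probability (n.-tuple T) R).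

Definition cons_prob : set (n.+1.-tuple T) -> \bar R :=
  pushforward (P \x Q) (@cons_pair n).

HB.instance Definition _ := Measure.copy cons_prob
  (measure_function_pushforward__canonical__measure_function_Measure (P \x Q)
    (measurable_cons_pair n)).

Lemma cons_prob_setT : cons_prob [set: n.+1.-tuple T] = 1.
Proof.
rewrite /cons_prob /pushforward preimage_setT -setXTT.
rewrite (product_measure1E P Q measurableT measurableT).
by rewrite [X in X * _](probability_setT P) [X in _ * X](probability_setT Q) mule1.
Qed.

HB.instance Definition _ :=
  Measure_isProbability.Build _ _ _ cons_prob cons_prob_setT.
End step.

(** The [n]-fold power of [P], built by recursion so that Tonelli's theorem splits off one
    coordinate at a time. *)
Fixpoint tuple_prob n : probability (n.-tuple T) R :=
  if n is m.+1 then cons_prob (tuple_prob m) else \d_[tuple].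

Lemma ge0_integral_tuple_probS n (f : n.+1.-tuple T -> \bar R) :
  measurable_fun [set: n.+1.-tuple T] f -> (forall t, 0 <= f t) ->
  \int[tuple_prob n.+1]_t f t =
  \int[P]_x \int[tuple_prob n]_t f [tuple of x :: t].
Proof.
move=> mf f0.
rewrite [LHS](@ge0_integral_pushforward _ _ _ _ _ _ (measurable_cons_pair n) _ setT)//.
rewrite preimage_setT fubini_tonelli1//.
- exact: measurableT_comp mf (measurable_cons_pair n).
- by move=> x; exact: f0.
Qed.

Lemma tuple_prob_bigcap n (A : 'I_n -> set T) : (forall i, measurable (A i)) ->
  tuple_prob n (\bigcap_(i in [set: 'I_n]) [set t | A i (tnth t i)]) = \prod_(i < n) P (A i).
Proof.
elim: n A => [|n IH] A mA.
  rewrite big_ord0 /= diracE mem_set// => -[]//.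
rewrite big_ord_recl -IH// /= /cons_prob /pushforward.
rewrite -product_measure1E//; last first.
  apply: fin_bigcap_measurable => [|i _]; first exact: finite_finset.
  by rewrite -[X in measurable X]setTI; exact: measurable_tnth.
congr ((_ \x _) _); apply/seteqP; split=> [[x t]/= H|[x t]/= [H0 H] i _].
  split; first exact: (H ord0 I).
  by move=> i _; have := H (lift ord0 i) I; rewrite /= tnthS.
have [->//|i0] := eqVneq i ord0.
have [j ->] : exists j, i = lift ord0 j.
  by case: (unliftP ord0 i) i0 => [j ->|->]; [exists j|rewrite eqxx].
by rewrite /= tnthS; exact: H.
Qed.

Lemma tuple_prob_indep n d' (T' : measurableType d') (g : 'I_n -> T -> T') :
  (forall i, measurable_fun [set: T] (g i)) ->
  mutually_independent (tuple_prob n) (fun i t => g i (tnth t i)).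
Proof.
move=> mg A mA.
have mgA i : measurable (g i @^-1` A i) by rewrite -[X in measurable X]setTI; exact: mg.
rewrite (tuple_prob_bigcap _ (fun i => g i @^-1` A i))//.
apply: eq_bigr => i _.
(* The marginal law of coordinate [i] is the box formula with every other side equal to the whole
   space. *)
pose B j : set T := if j == i then g i @^-1` A i else setT.
have mB j : measurable (B j) by rewrite /B; case: ifP.
have := tuple_prob_bigcap _ B mB.
rewrite (bigD1 i)//= big1 => [|j ji]; last by rewrite /B (negbTE ji) probability_setT.
rewrite mule1 {2}/B eqxx => <-; congr (tuple_prob n _).
apply/seteqP; split => [t /= /(_ i I)|t /= H j _]; rewrite /B; first by rewrite eqxx.
by case: eqP => [->|_]; [exact: H|].
Qed.

Lemma measurable_map_tuple d' (T' : measurableType d') n (phi : 'I_n -> T -> T') :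
  (forall i, measurable_fun [set: T] (phi i)) ->
  measurable_fun [set: n.-tuple T] (fun t : n.-tuple T => [tuple phi i (tnth t i) | i < n]).
Proof.
move=> mphi; apply/measurable_fun_tnthP => i.
rewrite (_ : _ \o _ = phi i \o (@tnth _ T ^~ i)); last first.
  by apply/funext => t /=; rewrite tnth_mktuple.
exact: measurableT_comp (mphi i) (measurable_tnth _).
Qed.

(** Change-of-variables densities multiply over independent coordinates. Gaussian arrays use this
    twice: along the entries of a row, then along the rows. *)
Lemma ge0_integral_tuple_prob_change n (phi : 'I_n -> T -> T) (h : 'I_n -> T -> R) :
  (forall i, measurable_fun [set: T] (phi i)) ->
  (forall i, measurable_fun [set: T] (h i)) ->
  (forall i x, (0 <= h i x)%R) ->
  (forall i (f : T -> \bar R), measurable_fun [set: T] f -> (forall x, 0 <= f x) ->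
    \int[P]_x f (phi i x) = \int[P]_x (f x * (h i x)%:E)) ->
  forall f : n.-tuple T -> \bar R,
  measurable_fun [set: n.-tuple T] f -> (forall t, 0 <= f t) ->
  \int[tuple_prob n]_t f [tuple phi i (tnth t i) | i < n] =
  \int[tuple_prob n]_t (f t * (\prod_(i < n) h i (tnth t i))%:E).
Proof.
elim: n phi h => [|n IH] phi h mphi mh h0 H f mf f0.
  apply: eq_integral => t _; rewrite big_ord0 mule1; congr (f _).
  by apply: eq_from_tnth => -[].
have mprod m (k : 'I_m -> T -> R) : (forall i, measurable_fun [set: T] (k i)) ->
    measurable_fun [set: m.-tuple T] (fun t => \prod_(i < m) k i (tnth t i))%R.
  move=> mk; apply: measurable_prod => i _.
  exact: measurableT_comp (mk i) (measurable_tnth _).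
have mprodE m (k : 'I_m -> T -> R) : (forall i, measurable_fun [set: T] (k i)) ->
    measurable_fun [set: m.-tuple T] (fun t => (\prod_(i < m) k i (tnth t i))%:E)%R.
  by move=> mk; apply/measurable_EFinP; exact: mprod.
have p0 m (k : 'I_m -> T -> R) (t : m.-tuple T) : (forall i x, 0 <= k i x)%R ->
   (0 <= (\prod_(i < m) k i (tnth t i)))%R by move=> k0; apply: prodr_ge0.
rewrite ge0_integral_tuple_probS//; last first.
  exact: measurableT_comp mf (measurable_map_tuple _ _ _ _ mphi).
rewrite ge0_integral_tuple_probS//; last 2 first.
- by apply: emeasurable_funM => //; exact: mprodE.
- by move=> t; rewrite mule_ge0// lee_fin p0.
pose h' i := h (lift ord0 i).
(* [F x] is the integral over the tail for a fixed head [x], after the induction hypothesis. It is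
   measurable by Tonelli, so the assumption on coordinate [ord0] applies to it. *)
pose F x := \int[tuple_prob n]_t (f [tuple of x :: t] * (\prod_(i < n) h' i (tnth t i))%:E).
have mfc : measurable_fun [set: T * n.-tuple T] (fun z : T * n.-tuple T => f [tuple of z.1 :: z.2]).
  exact: measurableT_comp mf (measurable_cons_pair n).
have mFz : measurable_fun [set: T * n.-tuple T] (fun z : T * n.-tuple T =>
    f [tuple of z.1 :: z.2] * (\prod_(i < n) h' i (tnth z.2 i))%:E).
  apply: emeasurable_funM => //.
  by apply: (measurableT_comp (mprodE n h' _)) => // i; exact: mh.
have mF : measurable_fun [set: T] F.
  apply: (@measurable_fun_fubini_tonelli_F _ _ T (n.-tuple T) R (tuple_prob n)
    (fun z : T * n.-tuple T => f [tuple of z.1 :: z.2] *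
      (\prod_(i < n) h' i (tnth z.2 i))%:E)) => //.
  by move=> z; rewrite mule_ge0// lee_fin p0// => i x; exact: h0.
have F0 x : 0 <= F x.
  by apply: integral_ge0 => t _; rewrite mule_ge0// lee_fin p0// => i y; exact: h0.
transitivity (\int[P]_x F (phi ord0 x)).
  apply: eq_integral => x _.
  rewrite /F -(IH (fun i => phi (lift ord0 i)) h' _ _ _ _
    (fun t => f [tuple of phi ord0 x :: t])); last 6 first.
  - by move=> i; exact: mphi.
  - by move=> i; exact: mh.
  - by move=> i y; exact: h0.
  - by move=> i; exact: H.
  - exact: (measurableT_comp mfc (pair1_measurable _)).
  - by move=> t; exact: f0.
  apply: eq_integral => t _; congr (f _); apply: eq_from_tnth => i.
  rewrite tnth_mktuple.
  have [->|[j ->]] : i = ord0 \/ exists j, i = lift ord0 j.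
  - by case: (unliftP ord0 i) => [j ->|->]; [right; exists j|left].
  - by rewrite tnth0.
  - by rewrite !tnthS tnth_mktuple.
rewrite H//; apply: eq_integral => x _.
rewrite /F -ge0_integralZr//; last 3 first.
- exact: (measurableT_comp mFz (pair1_measurable _)).
- by move=> t _; rewrite mule_ge0// lee_fin p0// => i y; exact: h0.
- by rewrite lee_fin.
apply: eq_integral => t _; rewrite -muleA -EFinM; congr (_ * _%:E).
rewrite big_ord_recl mulrC tnth0; congr (_ * _)%R.
by apply: eq_bigr => i _; rewrite tnthS.
Qed.

End tuple_prob.

(** * The Gaussian mechanism *)

Section ln_facts.
Context {R : realType}.

(** This follows from [ln x <= x - 1]. The crude bound lets additive constants be absorbed into
    [ln delta^-1] and [ln k%:R]. *)
Lemma half_le_ln_inv (x : R) : 0 < x <= 2^-1 -> 2^-1 <= ln x^-1.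
Proof.
move=> /andP[x0 x2].
have : ln (1 + (x - 1)) <= x - 1 by apply: le_ln1Dx; lra.
rewrite (_ : 1 + (x - 1) = x); last by ring.
by rewrite lnV ?posrE//; lra.
Qed.

Lemma half_le_ln_nat (k : nat) : (2 <= k)%N -> 2^-1 <= ln k%:R :> R.
Proof.
move=> k2; have := @half_le_ln_inv k%:R^-1; rewrite invrK; apply.
by rewrite invr_gt0 ltr0n lef_pV2 ?posrE ?ltr0n ?ler_nat ?k2 ?(leq_trans _ k2).
Qed.

End ln_facts.

Section gauss_matrix.
Local Open Scope ereal_scope.
Context {R : realType}.
Implicit Types (n l : nat).

Notation noise n l := (n.-tuple (l.-tuple (measurableTypeR R))).

(** Independent standard Gaussian entries, grouped by rows because one row is the private randomness
    of one node. *)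
Definition gauss_noise n l : probability (noise n l) R :=
  tuple_prob (tuple_prob gauss l) n.

(** The Frobenius inner product; under [gauss_noise] it is a centred Gaussian of variance
    [sqnorm a]. *)
Definition noise_dot {n l} (a : 'M[R]_(n, l)) (z : noise n l) : R :=
  (\sum_i \sum_j a i j * tnth (tnth z i) j)%R.

Definition sqnorm {n l} (a : 'M[R]_(n, l)) : R := (\sum_i \sum_j a i j ^+ 2)%R.

Definition noise_shift {n l} (a : 'M[R]_(n, l)) (z : noise n l) : noise n l :=
  [tuple [tuple (tnth (tnth z i) j + a i j : measurableTypeR R)%R | j < l] | i < n].

Lemma sqnorm_ge0 {n l} (a : 'M[R]_(n, l)) : (0 <= sqnorm a)%R.
Proof. by apply: sumr_ge0 => i _; apply: sumr_ge0 => j _; exact: sqr_ge0. Qed.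

Lemma sqnormZ {n l} c (a : 'M[R]_(n, l)) : sqnorm (c *: a) = (c ^+ 2 * sqnorm a)%R.
Proof.
rewrite /sqnorm mulr_sumr; apply: eq_bigr => i _; rewrite mulr_sumr.
by apply: eq_bigr => j _; rewrite mxE exprMn.
Qed.

Lemma noise_dotZ {n l} c (a : 'M[R]_(n, l)) z : noise_dot (c *: a) z = (c * noise_dot a z)%R.
Proof.
rewrite /noise_dot mulr_sumr; apply: eq_bigr => i _; rewrite mulr_sumr.
by apply: eq_bigr => j _; rewrite mxE mulrA.
Qed.

Lemma measurable_noise_entry {n l} i j :
  measurable_fun [set: noise n l] (fun z => tnth (tnth z i) j : R).
Proof. exact: (measurableT_comp (measurable_tnth _) (measurable_tnth _)). Qed.

Lemma measurable_noise_dot {n l} (a : 'M[R]_(n, l)) :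
  measurable_fun [set: noise n l] (noise_dot a).
Proof.
apply: measurable_sum => i; apply: measurable_sum => j.
by apply: measurable_funM => //; exact: measurable_noise_entry.
Qed.

Lemma measurable_noise_shift {n l} (a : 'M[R]_(n, l)) :
  measurable_fun [set: noise n l] (noise_shift a).
Proof.
apply: (@measurable_map_tuple _ (l.-tuple (measurableTypeR R)) _
  (l.-tuple (measurableTypeR R)) n
  (fun i (t : l.-tuple (measurableTypeR R)) =>
    [tuple (tnth t j + a i j : measurableTypeR R)%R | j < l])) => i.
apply: (@measurable_map_tuple _ (measurableTypeR R) _ (measurableTypeR R) l
  (fun j x => (x + a i j)%R)) => j.
exact: measurable_shift.
Qed.

(* The Cameron-Martin formula for the standard Gaussian measure on n-by-l arrays. *)
Lemma ge0_integral_noise_shift {n l} (a : 'M[R]_(n, l)) (f : noise n l -> \bar R) :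
  measurable_fun [set: noise n l] f -> (forall z, 0 <= f z) ->
  \int[gauss_noise n l]_z f (noise_shift a z) =
  \int[gauss_noise n l]_z (f z * (expR (noise_dot a z - sqnorm a / 2))%:E).
Proof.
move=> mf f0.
pose h i j (x : R) := expR (a i j * x - a i j ^+ 2 / 2).
have mh i j : measurable_fun [set: measurableTypeR R] (h i j).
  by apply: measurableT_comp => //; apply: measurable_funB.
have h0 i j x : (0 <= h i j x)%R by exact: expR_ge0.
pose hh i (t : l.-tuple (measurableTypeR R)) := (\prod_j h i j (tnth t j))%R.
have mhh i : measurable_fun [set: l.-tuple (measurableTypeR R)] (hh i).
  apply: measurable_prod => j _; exact: measurableT_comp (mh i j) (measurable_tnth _).
pose sh i (t : l.-tuple (measurableTypeR R)) :=
  [tuple (tnth t j + a i j : measurableTypeR R)%R | j < l].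
rewrite [LHS](@ge0_integral_tuple_prob_change _ _ R (tuple_prob gauss l) n sh hh)//.
- apply: eq_integral => z _; congr (_ * _%:E).
  rewrite /hh /h; under eq_bigr do rewrite -expR_sum.
  rewrite -expR_sum; congr expR; rewrite /noise_dot /sqnorm mulr_suml -sumrB.
  by apply: eq_bigr => i _; rewrite mulr_suml -sumrB.
- move=> i; apply: (@measurable_map_tuple _ (measurableTypeR R) _ (measurableTypeR R) l
    (fun j x => (x + a i j)%R)) => j.
  exact: measurable_shift.
- by move=> i t; apply: prodr_ge0.
- move=> i g mg g0.
  rewrite [LHS](@ge0_integral_tuple_prob_change _ _ R gauss l (fun j x => (x + a i j)%R) (h i))//.
  + by move=> j; exact: measurable_shift.
  + by move=> j g1 mg1 g10; exact: ge0_integral_gauss_shift.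
Qed.

(** The Gaussian moment generating function. The Cameron-Martin formula for the constant function 1
    says that the density integrates to 1. *)
Lemma integral_gauss_expR {n l} (a : 'M[R]_(n, l)) (c : R) :
  \int[gauss_noise n l]_z (expR (noise_dot a z + c))%:E = (expR (sqnorm a / 2 + c))%:E.
Proof.
have mE : measurable_fun [set: noise n l] (fun z => (expR (noise_dot a z - sqnorm a / 2))%:E).
  apply/measurable_EFinP; apply: measurableT_comp => //.
  by apply: measurable_funB => //; exact: measurable_noise_dot.
have H := ge0_integral_noise_shift a (cst 1) (measurable_cst _) (fun=> lee01).
transitivity (\int[gauss_noise n l]_z ((expR (sqnorm a / 2 + c))%:E *
    (expR (noise_dot a z - sqnorm a / 2))%:E)).
  apply: eq_integral => z _; rewrite -EFinM -expRD; congr (expR _)%:E.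
  by rewrite [RHS]addrC addrA subrK.
rewrite ge0_integralZl_EFin ?expR_ge0//.
transitivity ((expR (sqnorm a / 2 + c))%:E * \int[gauss_noise n l]_z cst 1 z).
  by congr (_ * _); rewrite H; apply: eq_integral => z _; rewrite mul1e.
by rewrite integral_cst// mul1e [X in _ * X](probability_setT (gauss_noise n l)) mule1.
Qed.

(** The likelihood ratio of shifted to unshifted noise is [expR u] with
    [u = noise_dot a z - sqnorm a / 2]. The region [u <= eps] gives the multiplicative term; a
    Chernoff bound with parameter [lam] bounds the rest by [delta]. *)
Lemma gauss_mechanism {n l} (a : 'M[R]_(n, l)) (eps delta : R) (B : set (noise n l)) :
  (0 < eps < 1)%R -> (0 < delta <= 2^-1)%R -> measurable B ->
  (sqnorm a * (4 * ln delta^-1) <= eps ^+ 2)%R ->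
  gauss_noise n l (noise_shift a @^-1` B) <=
    (expR eps)%:E * gauss_noise n l B + delta%:E.
Proof.
move=> /andP[e0 e1] /andP[d0 d2] mB ha.
set L := ln delta^-1 in ha.
have L0 : (2^-1 <= L)%R by apply: half_le_ln_inv; rewrite d0.
(* This choice gives [lam * eps = 2 * L], twice the decay needed to reach [delta = expR (- L)]; the
   surplus pays for the quadratic term. *)
pose lam : R := (2 * L / eps)%R.
have lam0 : (0 <= lam)%R by rewrite /lam divr_ge0// ?ltW//; lra.
(* [b] and [c] write the Chernoff exponent [u + lam * (u - eps)] as an affine function of the noise,
   whose exponential has an explicit integral. *)
pose b := ((1 + lam) *: a)%R.
pose c := (- ((1 + lam) * (sqnorm a / 2)) - lam * eps)%R.
have mb : measurable_fun [set: noise n l] (fun z => (expR (noise_dot b z + c))%:E).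
  apply/measurable_EFinP; apply: measurableT_comp => //.
  by apply: measurable_funD => //; exact: measurable_noise_dot.
have miB : measurable_fun [set: noise n l] (fun z => (\1_B z)%:E : \bar R).
  exact/measurable_EFinP/measurable_indic.
have mE : measurable_fun [set: noise n l] (fun z => (expR (noise_dot a z - sqnorm a / 2))%:E).
  apply/measurable_EFinP; apply: measurableT_comp => //.
  by apply: measurable_funB => //; exact: measurable_noise_dot.
have -> : gauss_noise n l (noise_shift a @^-1` B) =
    \int[gauss_noise n l]_z ((\1_B z)%:E * (expR (noise_dot a z - sqnorm a / 2))%:E).
  rewrite -(ge0_integral_noise_shift a (fun z => (\1_B z)%:E))//.
  rewrite (_ : (fun z => _) = fun z => (\1_(noise_shift a @^-1` B) z)%:E)//.
  rewrite integral_indic ?setIT//.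
  by rewrite -[X in measurable X]setTI; exact: measurable_noise_shift.
apply: (@le_trans _ _ (\int[gauss_noise n l]_z
    ((expR eps)%:E * (\1_B z)%:E + (expR (noise_dot b z + c))%:E))).
  apply: ge0_le_integral => //.
  - by apply: emeasurable_funM.

  - by apply: emeasurable_funD => //; apply: measurable_funeM.
  move=> z _; rewrite -!EFinM -EFinD lee_fin indicE.
  set u := (noise_dot a z - sqnorm a / 2)%R.
  have -> : (noise_dot b z + c = u + lam * (u - eps))%R.
    by rewrite /b /c /u noise_dotZ; ring.
  (* Either the density ratio [expR u] is at most [expR eps], or it is at most
     [expR u * expR (lam * (u - eps))], whose integral is an exponential moment. *)
  case: (z \in B); last by rewrite mul0r mulr0 add0r expR_ge0.
  rewrite mul1r mulr1; have [ue|/ltW eu] := leP u eps.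
    by rewrite -[leLHS]addr0 lerD ?ler_expR// expR_ge0.
  rewrite -[leLHS]add0r lerD ?expR_ge0// ler_expR lerDl mulr_ge0// subr_ge0//.
rewrite ge0_integralD//; last exact: measurable_funeM.
rewrite leeD//.
  rewrite ge0_integralZl_EFin ?expR_ge0//.
  by rewrite integral_indic// setIT.
rewrite integral_gauss_expR lee_fin -[leRHS]lnK ?posrE// ler_expR.
have -> : ln delta = (- L)%R by rewrite /L lnV ?posrE// opprK.
rewrite /b /c sqnormZ.
set q := sqnorm a in ha *.
have q0 : (0 <= q)%R by exact: sqnorm_ge0.
have le : (lam * eps = 2 * L)%R by rewrite /lam divfK// gt_eqF.
rewrite (_ : (1 + lam) ^+ 2 * q / 2 + _ = lam * (1 + lam) * q / 2 - lam * eps)%R; last by field.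
rewrite le.
(* With [lam ^+ 2 * q <= L] and [lam * q <= 1/2] the exponent is at most [1/4 - 3 * L / 2], which is
   at most [- L] because [L >= 1/2]. *)
have hl : (lam ^+ 2 * q <= L)%R.
  rewrite -(@ler_pM2r _ (eps ^+ 2)) ?exprn_gt0//.
  rewrite (_ : lam ^+ 2 * q * eps ^+ 2 = (lam * eps) ^+ 2 * q)%R; last by ring.
  rewrite le.
  have h : (L * (q * (4 * L)) <= L * eps ^+ 2)%R by rewrite ler_wpM2l//; lra.
  by rewrite (le_trans _ h)//; lra.
have hl2 : (lam * q <= 2^-1)%R.
  have L00 : (0 < L)%R by lra.
  rewrite -(@ler_pM2r _ (eps * (2 * L))) ?mulr_gt0//.
  rewrite (_ : lam * q * _ = (lam * eps) * (q * (2 * L)))%R; last by ring.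
  rewrite le.
  have h1 : (q * (4 * L) * L <= eps ^+ 2 * L)%R by rewrite ler_wpM2r// ltW.
  have h2 : (eps ^+ 2 <= eps)%R by rewrite expr2 ler_piMl// ltW.
  have h3 : (eps ^+ 2 * L <= eps * L)%R by rewrite ler_wpM2r// ltW.
  by lra.
by lra.
Qed.

End gauss_matrix.

(** * Expected maximum of Gaussian linear forms *)

Lemma measurable_bigmax {R : realType} d (T : measurableType d) (D : set T)
    (I : Type) (r : seq I) (h : I -> T -> R) :
  (forall i, measurable_fun D (h i)) ->
  measurable_fun D (fun x => \big[Num.max/0]_(i <- r) h i x).
Proof.
move=> mh; elim: r => [|i r IH].
  by under eq_fun do rewrite big_nil; exact: measurable_cst.
by under eq_fun do rewrite big_cons; exact: measurable_maxr.
Qed.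

Section gauss_max.
Local Open Scope ereal_scope.
Context {R : realType} {n l k : nat} (b : 'I_k -> 'M[R]_(n, l)) (tau : R).
Hypotheses (k2 : (2 <= k)%N) (tau0 : (0 < tau)%R).
Hypothesis b_tau : forall c, (sqnorm (b c) <= tau ^+ 2)%R.

(** The variance term of the moment generating function is at most [2 * ln k%:R], so subtracting
    [4 * ln k%:R] leaves at most [- 2 * ln k%:R]. *)
Let expmom (x : R) c : (x ^+ 2 * tau ^+ 2 <= 4 * ln k%:R)%R ->
  \int[gauss_noise n l]_z (expR (noise_dot (x *: b c) z - 4 * ln k%:R))%:E <= (k%:R ^- 2)%:E.
Proof.
move=> xt; rewrite integral_gauss_expR lee_fin.
have k0 : (0 < k%:R :> R)%R by rewrite ltr0n (leq_trans _ k2).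
rewrite -[leRHS]lnK ?posrE ?invr_gt0 ?exprn_gt0//.
rewrite ler_expR lnV ?posrE ?exprn_gt0// lnXn// sqnormZ -mulr_natl.
have : (x ^+ 2 * sqnorm (b c) <= x ^+ 2 * tau ^+ 2)%R by rewrite ler_wpM2l ?sqr_ge0.
by lra.
Qed.

(** Pointwise, [t] times the maximum is at most [4 * ln k%:R] plus the sum over all [c] and both
    signs of exponentials centred at that threshold. Each has integral at most [k%:R ^- 2], so the
    sum contributes at most [2 / k%:R]. *)
Lemma integral_gauss_max_le :
  \int[gauss_noise n l]_z (\big[Num.max/0%R]_(c < k) `|noise_dot (b c) z|%R)%:E <=
  (3 * tau * Num.sqrt (ln k%:R))%:E.
Proof.
have lk : (2^-1 <= ln k%:R :> R)%R by exact: half_le_ln_nat.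
have lk0 : (0 < ln k%:R :> R)%R by lra.
set q := Num.sqrt (ln k%:R).
have q0 : (0 < q)%R by rewrite sqrtr_gt0.
have qq : (q ^+ 2 = ln k%:R)%R by rewrite sqr_sqrtr// ltW.
have k0 : (0 < k%:R :> R)%R by rewrite ltr0n (leq_trans _ k2).
(* The largest scale allowed by [expmom], for [t] and [- t] alike. *)
pose t : R := (2 * q / tau)%R.
have t0 : (0 < t)%R by rewrite divr_gt0 ?mulr_gt0.
have tt : (t ^+ 2 * tau ^+ 2 = 4 * ln k%:R)%R.
  by rewrite -qq /t; field; rewrite gt_eqF.
pose e x c z : R := expR (noise_dot (x *: b c) z - 4 * ln k%:R).
have me x c : measurable_fun [set: n.-tuple (l.-tuple (measurableTypeR R))] (fun z => (e x c z)%:E).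
  apply/measurable_EFinP; apply: measurableT_comp => //.
  by apply: measurable_funB => //; exact: measurable_noise_dot.
have e0 x c z : 0 <= (e x c z)%:E by rewrite lee_fin expR_ge0.
pose F z : \bar R := (4 * ln k%:R)%:E + \sum_(c < k) ((e t c z)%:E + (e (- t)%R c z)%:E).
have mS : measurable_fun [set: n.-tuple (l.-tuple (measurableTypeR R))]
    (fun z => \sum_(c < k) ((e t c z)%:E + (e (- t)%R c z)%:E)).
  by apply: emeasurable_sum => c; exact: emeasurable_funD.
have mF : measurable_fun [set: n.-tuple (l.-tuple (measurableTypeR R))] F.
  by apply: emeasurable_funD.
have S0 z : 0 <= \sum_(c < k) ((e t c z)%:E + (e (- t)%R c z)%:E).
  by apply: sume_ge0 => c _; rewrite adde_ge0.
have c0 : 0 <= (4 * ln k%:R)%:E :> \bar R by rewrite lee_fin; lra.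
have F0 z : 0 <= F z by rewrite adde_ge0.
apply: (@le_trans _ _ (\int[gauss_noise n l]_z (t^-1%:E * F z))).
  apply: ge0_le_integral => //.
  - move=> z _; rewrite lee_fin; exact: bigmax_ge_id.
  - apply/measurable_EFinP; apply: measurable_bigmax => c.
    by apply: measurableT_comp => //; exact: measurable_noise_dot.
  - exact: measurable_funeM.
  move=> z _; rewrite /F.
  have -> : \sum_(i < k) ((e t i z)%:E + (e (- t)%R i z)%:E) =
      (\sum_(i < k) (e t i z + e (- t)%R i z))%R%:E.
    by rewrite -sumEFin; apply: eq_bigr => i _; rewrite EFinD.
  rewrite -EFinD -EFinM lee_fin.
  apply: bigmax_le => [|c _].
    rewrite mulr_ge0 ?invr_ge0 ?ltW// ltr_wpDr ?mulr_gt0// sumr_ge0// => i _.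
    by rewrite addr_ge0 ?expR_ge0.
  rewrite ler_pdivlMl//.
  set y := noise_dot (b c) z.
  (* The bound [x <= expR x] replaces a maximum by exponentials that can be summed and integrated;
     keeping both signs covers the absolute value. *)
  have h1 : (t * `|y| - 4 * ln k%:R <= expR (t * `|y| - 4 * ln k%:R))%R.
    by apply: le_trans (expR_ge1Dx _); rewrite lerDr.
  have h2 : (expR (t * `|y| - 4 * ln k%:R) <= e t c z + e (- t)%R c z)%R.
    rewrite /e !noise_dotZ -/y mulNr -mulrN.
    by case: (ger0P y) => _; rewrite ?lerDl ?lerDr expR_ge0.
  have h3 : (e t c z + e (- t)%R c z <= \sum_(i < k) (e t i z + e (- t)%R i z))%R.
    rewrite (bigD1 c)//= lerDl sumr_ge0// => i _.
    by rewrite addr_ge0 ?expR_ge0.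
  by lra.
rewrite ge0_integralZl_EFin ?invr_ge0 ?(ltW t0)//.
rewrite ge0_integralD// integral_cst// [X in _ * X + _](probability_setT (gauss_noise n l)) mule1.
rewrite ge0_integral_sum//; last 2 first.
- by move=> c; exact: emeasurable_funD.
- by move=> c z _; rewrite adde_ge0.
apply: (@le_trans _ _ (t^-1%:E * ((4 * ln k%:R)%:E + \sum_(c < k) (2 * k%:R ^- 2)%:E))).
  rewrite lee_wpmul2l ?lee_fin ?invr_ge0 ?(ltW t0)// leeD2l//.
  apply: lee_sum => c _; rewrite ge0_integralD//.
  have -> : (2 * k%:R ^- 2 = k%:R ^- 2 + k%:R ^- 2 :> R)%R by ring.
  rewrite EFinD leeD// expmom// ?sqrrN tt//.
rewrite sumEFin -EFinD -EFinM lee_fin sumr_const card_ord -[(2 * _ *+ k)%R]mulr_natr.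
rewrite ler_pdivrMl// /t.
have -> : (2 * q / tau * (3 * tau * q) = 6 * q ^+ 2)%R by field; rewrite gt_eqF.
rewrite qq.
have -> : (2 * k%:R ^- 2 * k%:R = 2 / k%:R :> R)%R by field; rewrite gt_eqF.
(* Since [1 <= 2 * ln k%:R], the total is at most [6 * ln k%:R]; dividing by [t] gives the constant
   3. *)
have : (2 / k%:R <= 1 :> R)%R by rewrite ler_pdivrMr// mul1r ler_nat.
by lra.
Qed.

End gauss_max.

(** * Factorizations and sensitivity *)

Section norms.
Context {R : realType}.

Lemma norm_2_inf_ge0 {m p} (A : 'M[R]_(m, p)) : 0 <= norm_2_inf A.
Proof. exact: bigmax_ge_id. Qed.

Lemma norm_1_2_ge0 {m p} (A : 'M[R]_(m, p)) : 0 <= norm_1_2 A.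
Proof. exact: bigmax_ge_id. Qed.

Lemma sum_sqr_row_le {m p} (A : 'M[R]_(m, p)) i :
  \sum_(j < p) A i j ^+ 2 <= norm_2_inf A ^+ 2.
Proof.
rewrite -[leLHS]sqr_sqrtr ?sumr_ge0// => [|j _]; last exact: sqr_ge0.
rewrite ler_pXn2r ?nnegrE ?sqrtr_ge0 ?norm_2_inf_ge0//.
exact: (le_bigmax _ (fun i => Num.sqrt (\sum_(j < p) A i j ^+ 2))).
Qed.

Lemma sum_sqr_col_le {m p} (A : 'M[R]_(m, p)) j :
  \sum_(i < m) A i j ^+ 2 <= norm_1_2 A ^+ 2.
Proof.
rewrite -[leLHS]sqr_sqrtr ?sumr_ge0// => [|i _]; last exact: sqr_ge0.
rewrite ler_pXn2r ?nnegrE ?sqrtr_ge0 ?norm_1_2_ge0//.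
exact: (le_bigmax _ (fun j => Num.sqrt (\sum_(i < m) A i j ^+ 2))).
Qed.

Lemma norm_1_inf_ge {m p} (A : 'M[R]_(m, p)) i j : `|A i j| <= norm_1_inf A.
Proof.
apply: le_trans (le_bigmax _ (fun j => `|A i j|) j) _.
exact: (le_bigmax _ (fun i => \big[Num.max/0]_(j < p) `|A i j|)).
Qed.

Lemma norm_1_inf_le {m p} (A : 'M[R]_(m, p)) (x : R) : 0 <= x ->
  (forall i j, `|A i j| <= x) -> norm_1_inf A <= x.
Proof. by move=> x0 H; apply: bigmax_le => // i _; apply: bigmax_le. Qed.

(** Cauchy-Schwarz by Lagrange's identity: the difference of the two sides is half a sum of squared
    2-by-2 minors. *)
Lemma sqr_sum_mul_le {m} (x y : 'I_m -> R) :
  (\sum_k x k * y k) ^+ 2 <= (\sum_k x k ^+ 2) * (\sum_k y k ^+ 2).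
Proof.
have : 0 <= \sum_j \sum_k (x j * y k - x k * y j) ^+ 2.
  by apply: sumr_ge0 => j _; apply: sumr_ge0 => k _; exact: sqr_ge0.
have -> : \sum_j \sum_k (x j * y k - x k * y j) ^+ 2 =
   \sum_j \sum_k x j ^+ 2 * y k ^+ 2 + \sum_j \sum_k x k ^+ 2 * y j ^+ 2
   - 2 * \sum_j \sum_k (x j * y j) * (x k * y k).
  rewrite mulr_sumr -big_split -sumrB; apply: eq_bigr => j _ /=.
  rewrite mulr_sumr -big_split -sumrB; apply: eq_bigr => k _ /=; ring.
rewrite [X in _ + X - _]exchange_big /=.
have E (f g : 'I_m -> R) : \sum_j \sum_k f j * g k = (\sum_j f j) * (\sum_k g k).
  by rewrite mulr_suml; apply: eq_bigr => j _; rewrite mulr_sumr.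
rewrite (E (fun j => x j ^+ 2)) (E (fun j => x j * y j)) -expr2.
lra.
Qed.

Lemma normr_mulmx_le {m p q} (A : 'M[R]_(m, p)) (B : 'M[R]_(p, q)) i j :
  `|(A *m B) i j| <= norm_2_inf A * norm_1_2 B.
Proof.
rewrite -(@ler_pXn2r _ 2) ?nnegrE ?mulr_ge0 ?norm_2_inf_ge0 ?norm_1_2_ge0//.
rewrite real_normK ?num_real// mxE exprMn.
apply: le_trans (sqr_sum_mul_le _ _) _.
by rewrite ler_pM ?sum_sqr_row_le ?sum_sqr_col_le// sumr_ge0// => k _; exact: sqr_ge0.
Qed.

(** The squared form of the operator bound from l1 to l2. Expanding the square gives the Gram matrix
    of the columns, whose entries are at most [norm_1_2 A ^+ 2] by the arithmetic-geometric mean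
    inequality. *)
Lemma sum_sqr_mulmx_le {m p} (A : 'M[R]_(m, p)) (c : 'I_p -> R) :
  \sum_i (\sum_j A i j * c j) ^+ 2 <= (norm_1_2 A * \sum_j `|c j|) ^+ 2.
Proof.
have -> : \sum_i (\sum_j A i j * c j) ^+ 2 =
    \sum_j \sum_k c j * c k * \sum_i A i j * A i k.
  under eq_bigr do rewrite expr2 mulr_suml.
  rewrite exchange_big /=; apply: eq_bigr => j _.
  under eq_bigr do rewrite mulr_sumr.
  rewrite exchange_big /=; apply: eq_bigr => k _.
  by rewrite mulr_sumr; apply: eq_bigr => i _; ring.
rewrite mulrC exprMn expr2 mulr_suml mulr_suml.
apply: ler_sum => j _; rewrite -mulrA mulr_suml mulr_sumr.
apply: ler_sum => k _; rewrite mulrA.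
apply: le_trans (ler_norm _) _; rewrite !normrM ler_wpM2l ?mulr_ge0//.
apply: le_trans (ler_norm_sum _ _ _) _.
apply: (@le_trans _ _ (\sum_i (A i j ^+ 2 + A i k ^+ 2) / 2)).
  apply: ler_sum => i _; rewrite normrM.
  have := sqr_ge0 (`|A i j| - `|A i k|).
  rewrite sqrrB !real_normK ?num_real//; lra.
rewrite -mulr_suml big_split /=.
by have := sum_sqr_col_le A j; have := sum_sqr_col_le A k; lra.
Qed.

End norms.

(** * The law of a randomly rounded degree *)

Section blur.
Context {R : realType} (s : nat).
Hypothesis s_gt0 : (0 < s)%N.
Local Notation blur := (@blur_prob R s).

Let s0 : 0 < s%:R :> R. Proof. by rewrite ltr0n. Qed.

Lemma blur_probE x j : let p := (x %% s)%N%:R / s%:R in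
  blur x j = (1 - p) * (j == x %/ s)%N%:R + p * (j == (x %/ s).+1)%N%:R.
Proof. by rewrite /blur_prob /=; do 2 case: ifP => _; rewrite ?mulr1 ?mulr0. Qed.

Lemma blur_prob_ge0 x j : 0 <= blur x j.
Proof.
rewrite blur_probE addr_ge0 ?mulr_ge0 ?divr_ge0 ?ler0n//.
by rewrite subr_ge0 ler_pdivrMr// mul1r ler_nat ltnW// ltn_mod.
Qed.

(** At most one index equals [q], and none does when [q] lies beyond the range. *)
Lemma sum_delta_le m q : \sum_(j < m) ((j : nat) == q)%:R <= 1 :> R.
Proof.
rewrite (_ : \sum_(j < m) _ = \sum_(j < m | (j : nat) == q) 1); last first.
  by rewrite [RHS]big_mkcond; apply: eq_bigr => j _; case: eqP.
case: (ltnP q m) => qm.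
  by rewrite (big_pred1 (Ordinal qm))// => j; rewrite -val_eqE.
rewrite big1 ?ler01// => j /eqP jq; move: (ltn_ord j); rewrite jq ltnNge qm//.
Qed.

Lemma sum_blur_prob_le1 m x : \sum_(j < m) blur x j <= 1.
Proof.
under eq_bigr do rewrite blur_probE.
rewrite big_split /= -!mulr_sumr.
set p := _ / _.
have p0 : 0 <= p by rewrite divr_ge0.
have p1 : 0 <= 1 - p by rewrite subr_ge0 ler_pdivrMr// mul1r ler_nat ltnW// ltn_mod.
rewrite -[leRHS](subrK p) lerD//.
  by rewrite -[leRHS]mulr1 ler_wpM2l// sum_delta_le.
by rewrite -[leRHS]mulr1 ler_wpM2l// sum_delta_le.
Qed.

(** A unit step moves mass [1/s] from the floor of [x/s] to its successor. This also holds when [s]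
    divides [x.+1]: the Bernoulli parameter wraps from [(s-1)/s] to 0 just as the floor
    increases. *)
Lemma blur_probS x j :
  blur x.+1 j - blur x j = s%:R^-1 * ((j == (x %/ s).+1)%:R - (j == x %/ s)%N%:R).
Proof.
rewrite !blur_probE modnS divnS//; case: ifPn => sx.
  rewrite add1n mul0r subr0 mul1r mul0r addr0.
  have -> : (x %% s)%:R = s%:R - 1 :> R.
    suff E : ((x %% s).+1 = s)%N by rewrite -[in RHS]E -natr1 addrK.
    apply/eqP; rewrite eqn_leq ltn_mod s_gt0/=.
    by rewrite dvdn_leq// -addn1 /dvdn modnDml addn1.
  field; rewrite gt_eqF//.
by rewrite add0n -natr1; field; rewrite gt_eqF.
Qed.

Lemma dist_blur_probS m x : \sum_(j < m) `|blur x.+1 j - blur x j| <= 2 / s%:R.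
Proof.
apply: (@le_trans _ _ (\sum_(j < m) s%:R^-1 *
    (((j : nat) == (x %/ s).+1)%:R + ((j : nat) == x %/ s)%N%:R))).
  apply: ler_sum => j _; rewrite blur_probS normrM ger0_norm ?invr_ge0//.
  by rewrite ler_wpM2l ?invr_ge0// (le_trans (ler_normB _ _))// !ger0_norm.
rewrite -mulr_sumr big_split /= mulrC ler_wpM2r ?invr_ge0//.
by rewrite -[2]/(1 + 1) lerD ?sum_delta_le.
Qed.

Lemma dist_blur_prob m x y : \sum_(j < m) `|blur x j - blur y j| <= 2.
Proof.
apply: (@le_trans _ _ (\sum_(j < m) (blur x j + blur y j))).
  apply: ler_sum => j _; rewrite (le_trans (ler_normB _ _))//.
  by rewrite !ger0_norm ?blur_prob_ge0.
by rewrite big_split /= -[2]/(1 + 1) lerD ?sum_blur_prob_le1.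
Qed.

End blur.

(** * Degrees under rewiring, and sensitivity of the encoding *)

Section graphs.
Context {n : nat}.
Implicit Types G : graph n.

Lemma deg_lt G i : (deg G i < n)%N.
Proof.
have : nbhd G i \proper [set: 'I_n]%SET.
  by rewrite properT; apply/negP => /eqP/setP/(_ i); rewrite !inE adj_irr.
by move=> /proper_card; rewrite cardsT card_ord.
Qed.

(** Away from the rewired node [v], two neighborhoods of the same node can differ only in whether
    they contain [v]. *)
Lemma node_neighbors_deg G G' : node_neighbors G G' ->
  exists v, forall i, i != v -> deg G i = deg G' i \/
    deg G i = (deg G' i).+1 \/ deg G' i = (deg G i).+1.
Proof.
move=> [v H]; exists v => i iv.
rewrite /deg (cardsD1 v (nbhd G i)) (cardsD1 v (nbhd G' i)).
have -> : nbhd G i :\ v = nbhd G' i :\ v.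
  by apply/setP => j; rewrite !inE; case: eqVneq => //= jv; exact: H.
by case: (v \in _); case: (v \in _); auto.
Qed.

Context {R : realType}.

Lemma deg_distrE G (d : 'I_n) :
  @deg_distr R n G d = (\sum_i (deg G i == d)%:R) / n%:R.
Proof.
rewrite /deg_distr (@eq_card _ _ [pred i | deg G i == d]) => [|i]; last first.
  by apply/idP/idP => [/set_mem//|h]; exact: mem_set.
rewrite -sum1_card natr_sum big_mkcond; congr (_ / _).
by apply: eq_bigr => i _; rewrite inE; case: ifP.
Qed.

(** Exchanging the sums over degrees and nodes turns the blurred histogram into an average of terms
    that each node computes from its own degree. *)
Lemma cbddE s G j : @cbdd R n s G j ord0 =
  n%:R^-1 * \sum_i blur_prob s (deg G i) j.
Proof.
rewrite mxE mulr_sumr.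
under eq_bigr do rewrite deg_distrE !mulr_suml.
rewrite exchange_big /=; apply: eq_bigr => i _.
rewrite (bigD1 (Ordinal (deg_lt G i)))//= eqxx mul1r big1 ?addr0// => d.
by rewrite -val_eqE /= eq_sym => /negbTE ->; rewrite !mul0r.
Qed.

Lemma cbdd_ge0 s G j : (0 < s)%N -> 0 <= @cbdd R n s G j ord0.
Proof.
by move=> s0; rewrite cbddE mulr_ge0 ?invr_ge0// sumr_ge0// => i _; exact: blur_prob_ge0.
Qed.

Lemma sum_cbdd_le1 s G : (0 < s)%N -> \sum_j @cbdd R n s G j ord0 <= 1.
Proof.
move=> s0; under eq_bigr do rewrite cbddE.
rewrite -mulr_sumr exchange_big /=.
case: (posnP n) => [n0|n0].
  by rewrite [in n%:R]n0 invr0 mul0r.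
rewrite mulrC ler_pdivrMr ?ltr0n// mul1r.
rewrite -[n in leRHS]card_ord -sum1_card natr_sum; apply: ler_sum => i _.
exact: sum_blur_prob_le1.
Qed.

(** The noiseless message: [A] applied to the law of the rounded degree. *)
Definition encode {l m} s (A : 'M[R]_(l, m)) (x : nat) (j : 'I_l) : R :=
  \sum_t A j t * blur_prob s x t.

Lemma encode_dist {l m} s (A : 'M[R]_(l, m)) x y :
  \sum_j (encode s A x j - encode s A y j) ^+ 2 <=
  (norm_1_2 A * \sum_(t < m) `|blur_prob s x t - blur_prob s y t|) ^+ 2.
Proof.
apply: le_trans (sum_sqr_mulmx_le _ _).
apply: ler_sum => j _; rewrite /encode -sumrB.
by under [in leRHS]eq_bigr do rewrite mulrBr.
Qed.

Lemma encode_sensitivity {l m} s (A : 'M[R]_(l, m)) G G' : (0 < s)%N ->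
  node_neighbors G G' ->
  \sum_i \sum_j (encode s A (deg G i) j - encode s A (deg G' i) j) ^+ 2 <=
  4 * norm_1_2 A ^+ 2 * (1 + n%:R / s%:R ^+ 2).
Proof.
move=> s0 /node_neighbors_deg [v H].
have sR : 0 < s%:R :> R by rewrite ltr0n.
have A0 := norm_1_2_ge0 A.
have mono (x y : R) : 0 <= x -> x <= y -> (norm_1_2 A * x) ^+ 2 <= norm_1_2 A ^+ 2 * y ^+ 2.
  move=> x0 xy; rewrite exprMn ler_wpM2l ?sqr_ge0//.
  by rewrite ler_pXn2r ?nnegrE// (le_trans x0).
(* The degree of [v] can change arbitrarily, so only the trivial l1 bound 2 applies to it; the other
   nodes enjoy the bound [2 / s]. *)
rewrite (bigD1 v)//= mulrDr mulr1 lerD//.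
  apply: le_trans (encode_dist _ _ _ _) _.
  apply: le_trans (mono _ 2 _ _) _; first by apply: sumr_ge0.
    exact: dist_blur_prob.
  by lra.
(* The sum is extended to all [n] nodes by adding a nonnegative term for [v]. *)
apply: (@le_trans _ _ (\sum_(i < n) norm_1_2 A ^+ 2 * (2 / s%:R) ^+ 2)).
  rewrite big_mkcond; apply: ler_sum => i _; case: ifPn => iv; last first.
    by rewrite mulr_ge0 ?sqr_ge0.
  apply: le_trans (encode_dist _ _ _ _) _; apply: mono; first exact: sumr_ge0.
  have [->|[->|->]] := H i iv.
  - by rewrite big1 ?divr_ge0// => j _; rewrite subrr normr0.
  - exact: dist_blur_probS.
  - by under eq_bigr do rewrite distrC; exact: dist_blur_probS.
rewrite sumr_const card_ord -[leLHS]mulr_natr le_eqVlt; apply/orP; left; apply/eqP.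
by field; rewrite gt_eqF.
Qed.

End graphs.

(** * Near-optimal factorizations *)

Section gamma.
Context {R : realType} {k m : nat} (eta : R) (W : 'M[R]_(k, m)).
Hypothesis eta_ge0 : 0 <= eta.

Let S := [set x | exists (l : nat) (L : 'M[R]_(k, l)) (A : 'M[R]_(l, m)),
  norm_1_inf (L *m A - W) <= eta /\ x = norm_2_inf L * norm_1_2 A].

(** The factorization of [W] through the identity matrix makes the set nonempty, and norms are
    nonnegative. *)
Let has_infS : has_inf S.
Proof.
split; last by exists 0 => _ [l [L [A [_ ->]]]]; rewrite mulr_ge0 ?norm_2_inf_ge0 ?norm_1_2_ge0.
exists (norm_2_inf W * norm_1_2 (1%:M : 'M[R]_m)), m, W, 1%:M; split => //.
by rewrite mulmx1 subrr norm_1_inf_le// => i j; rewrite mxE normr0.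
Qed.

Lemma gamma_eta_ge0 : 0 <= gamma_eta eta W.
Proof.
apply: lb_le_inf; first by case: has_infS.
by move=> _ [l [L [A [_ ->]]]]; rewrite mulr_ge0 ?norm_2_inf_ge0 ?norm_1_2_ge0.
Qed.

Lemma gamma_eta_factorization e : 0 < e ->
  exists (l : nat) (L : 'M[R]_(k, l)) (A : 'M[R]_(l, m)),
  norm_1_inf (L *m A - W) <= eta /\
  gamma_eta eta W <= norm_2_inf L * norm_1_2 A < gamma_eta eta W + e.
Proof.
move=> e0; have [x Sx xe] := inf_adherent e0 has_infS.
have gx : gamma_eta eta W <= x by apply: ge_inf => //; case: has_infS.
case: Sx => l [L [A [LA xE]]]; exists l, L, A; split => //.
by rewrite -xE gx.
Qed.

(** An entry of [L *m A] is bounded by Cauchy-Schwarz and is within [eta] of that of [W]; the slack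
    [e] then tends to 0. This serves the case [gamma_eta eta W = 0]. *)
Lemma normr_le_gamma_eta i j : `|W i j| <= eta + gamma_eta eta W.
Proof.
apply/ler_addgt0Pr => e e0.
have [l [L [A [LA /andP[_ he]]]]] := gamma_eta_factorization _ e0.
have h1 := le_trans (norm_1_inf_ge _ i j) LA.
have h2 := normr_mulmx_le L A i j.
have -> : W i j = (L *m A) i j - (L *m A - W) i j by rewrite !mxE; ring.
apply: le_trans (ler_normB _ _) _.
by lra.
Qed.

End gamma.

(** * The algorithm *)

Section algorithm.
Context {R : realType} {n s k l : nat} (L : 'M[R]_(k, l)) (A : 'M[R]_(l, nu n s)) (sigma : R).
Local Notation msg := (l.-tuple (measurableTypeR R)).
Local Notation noise := (n.-tuple msg).

Definition noisy_encode (N : {set 'I_n}) (t : msg) : msg :=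
  [tuple (encode s A #|N| j + sigma * tnth t j : measurableTypeR R) | j < l].

Definition noisy_rand (i : 'I_n) (rho : unit) (N : {set 'I_n}) (z : noise) : msg :=
  noisy_encode N (tnth z i).

Definition decode (t : n.-tuple msg) : 'cV[R]_k :=
  \col_c (n%:R^-1 * \sum_i \sum_j L c j * tnth (tnth t i) j).

Lemma measurable_noisy_encode N : measurable_fun [set: msg] (noisy_encode N).
Proof.
apply: (@measurable_map_tuple _ (measurableTypeR R) _ (measurableTypeR R) l
  (fun j (x : R) => (encode s A #|N| j + sigma * x)%R)) => j.
by apply: measurable_funD.
Qed.

Lemma measurable_noisy_rand i N :
  measurable_fun [set: (unit * noise)%type] (fun x => noisy_rand i x.1 N x.2).
Proof.
apply: (measurableT_comp (measurable_noisy_encode N)).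
exact: (measurableT_comp (measurable_tnth i) measurable_snd).
Qed.

Lemma measurable_decode c : measurable_fun [set: n.-tuple msg] (fun t => decode t c ord0).
Proof.
rewrite (_ : (fun _ => _) = (fun t : n.-tuple msg =>
   n%:R^-1 * noise_dot (\matrix_(i, j) L c j) t)); last first.
  apply/funext => t; rewrite mxE /noise_dot; congr (_ * _).
  by apply: eq_bigr => i _; apply: eq_bigr => j _; rewrite mxE.
by apply: measurable_funM => //; exact: measurable_noise_dot.
Qed.

Lemma noisy_rand_indep (rho : unit) (N : 'I_n -> {set 'I_n}) :
  mutually_independent (gauss_noise n l) (fun i => noisy_rand i rho (N i)).
Proof.
apply: (@tuple_prob_indep _ msg R (tuple_prob gauss l) n _ msg (fun i => noisy_encode (N i))).
by move=> i; exact: measurable_noisy_encode.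
Qed.

(** The public string is trivial. All nodes share one space of noise arrays, and node [i] reads only
    row [i], whence independence. *)
Definition gauss_alg : @local_alg R n k :=
  @LocalAlg R n k _ unit (\d_tt : probability unit R) _ noise (gauss_noise n l)
    _ msg noisy_rand decode measurable_noisy_rand measurable_decode noisy_rand_indep.

Lemma measurable_rand_out (G : graph n) :
  measurable_fun [set: noise] (rand_out gauss_alg G tt : noise -> noise).
Proof.
apply: (@measurable_map_tuple _ msg _ msg n (fun i => noisy_encode (nbhd G i))) => i.
exact: measurable_noisy_encode.
Qed.

(** Changing the graph translates the messages, which amounts to translating the noise by the
    difference of encodings divided by [sigma]. Privacy thus reduces to [gauss_mechanism]. *)
Lemma rand_out_shift (G G' : graph n) (z : noise) : sigma != 0 ->
  rand_out gauss_alg G tt z = rand_out gauss_alg G' tt (noise_shift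
    (\matrix_(i, j) ((encode s A (deg G i) j - encode s A (deg G' i) j) / sigma)) z) :> noise.
Proof.
move=> s0; apply: eq_from_tnth => i; rewrite /rand_out !tnth_mktuple.
apply: eq_from_tnth => j; rewrite /= /noisy_rand /noisy_encode !tnth_mktuple mxE /deg.
by rewrite /=; field.
Qed.

Lemma gauss_alg_LNDP (eps delta : R) : (0 < s)%N ->
  0 < eps < 1 -> 0 < delta <= 2^-1 -> 0 < sigma ->
  4 * norm_1_2 A ^+ 2 * (1 + n%:R / s%:R ^+ 2) * (4 * ln delta^-1) <= eps ^+ 2 * sigma ^+ 2 ->
  is_LNDP eps delta gauss_alg.
Proof.
move=> s0 he hd sg hs [] G G' GG'.
have GG'' : node_neighbors G' G.
  by case: GG' => v H; exists v => i j iv jv; rewrite H.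
have L0 : 0 <= 4 * ln delta^-1.
  by have := half_le_ln_inv delta hd; lra.
(* The relation on graphs is symmetric, so one inequality yields both. *)
have main (G1 G2 : graph n) (Y : set noise) : node_neighbors G1 G2 -> measurable Y ->
    (gauss_noise n l ((rand_out gauss_alg G1 tt : noise -> noise) @^-1` Y) <=
    (expR eps)%:E * gauss_noise n l ((rand_out gauss_alg G2 tt : noise -> noise) @^-1` Y)
      + delta%:E)%E.
  move=> G12 mY.
  set a := \matrix_(i < n, j < l) ((encode s A (deg G1 i) j - encode s A (deg G2 i) j) / sigma).
  have -> : (rand_out gauss_alg G1 tt : noise -> noise) @^-1` Y =
      noise_shift a @^-1` ((rand_out gauss_alg G2 tt : noise -> noise) @^-1` Y).
    apply/seteqP; split => z /=; rewrite (rand_out_shift G1 G2) ?gt_eqF//.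
  apply: gauss_mechanism => //.
    by rewrite -[X in measurable X]setTI; exact: measurable_rand_out.
  have -> : sqnorm a = sigma ^- 2 *
      \sum_i \sum_j (encode s A (deg G1 i) j - encode s A (deg G2 i) j) ^+ 2.
    rewrite /sqnorm mulr_sumr; apply: eq_bigr => i _; rewrite mulr_sumr.
    by apply: eq_bigr => j _; rewrite mxE exprMn exprVn mulrC.
  rewrite -mulrA ler_pdivrMl ?exprn_gt0// [leRHS]mulrC.
  apply: le_trans hs; rewrite ler_wpM2r//.
  exact: encode_sensitivity.
by move=> Y mY; split; exact: main.
Qed.

(** Decoding is linear, so the output splits into a deterministic part and a Gaussian form in the
    noise. *)
Lemma alg_outputE (G : graph n) (z : noise) c : (0 < n)%N ->
  alg_output gauss_alg G tt z c ord0 =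
  (L *m A *m cbdd s G) c ord0 +
  noise_dot (\matrix_(i < n, j < l) (sigma / n%:R * L c j)) z.
Proof.
move=> n0; have nR : n%:R != 0 :> R by rewrite pnatr_eq0 -lt0n.
rewrite /alg_output /= mxE.
have -> : (L *m A *m cbdd s G) c ord0 =
    n%:R^-1 * \sum_i \sum_j L c j * encode s A (deg G i) j.
  rewrite -mulmxA mxE; under eq_bigr => j _.
    rewrite mxE; under eq_bigr do rewrite cbddE.
    over.
  rewrite exchange_big /= mulr_sumr; apply: eq_bigr => j _.
  rewrite -mulr_sumr mulrCA; congr (_ * _).
  rewrite /encode exchange_big /= mulr_sumr; apply: eq_bigr => t _.
  by rewrite -mulr_sumr mulrCA.
rewrite /noise_dot !mulr_sumr -big_split /=; apply: eq_bigr => i _.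
rewrite !mulr_sumr -big_split /=; apply: eq_bigr => j _.
rewrite /rand_out tnth_mktuple /= /noisy_rand /noisy_encode tnth_mktuple mxE /deg.
by field.
Qed.

Lemma gauss_alg_error (eta : R) (W : 'M[R]_(k, nu n s)) (G : graph n) :
  (0 < n)%N -> (0 < s)%N -> (2 <= k)%N -> 0 <= eta ->
  0 < sigma -> 0 < norm_2_inf L ->
  norm_1_inf (L *m A - W) <= eta ->
  (expected_error s gauss_alg W G <=
   (eta + 3 * (sigma * norm_2_inf L / Num.sqrt n%:R) * Num.sqrt (ln k%:R))%:E)%E.
Proof.
move=> n0 s0 k2 eta0 sg Lg LA.
have nR : 0 < n%:R :> R by rewrite ltr0n.
set b := fun c => \matrix_(i < n, j < l) (sigma / n%:R * L c j).
(* Each of the [n] rows of [b c] has squared norm [(sigma / n) ^+ 2] times that of row [c] of [L],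
   so averaging leaves a factor [1 / n] in the variance. *)
set tau := sigma * norm_2_inf L / Num.sqrt n%:R.
have tau0 : 0 < tau by rewrite divr_gt0 ?mulr_gt0 ?sqrtr_gt0.
have btau c : sqnorm (b c) <= tau ^+ 2.
  have -> : sqnorm (b c) = sigma ^+ 2 / n%:R * \sum_j L c j ^+ 2.
    rewrite /sqnorm (eq_bigr (fun=> (sigma / n%:R) ^+ 2 * \sum_j L c j ^+ 2)); last first.
      by move=> i _; rewrite mulr_sumr; apply: eq_bigr => j _; rewrite mxE exprMn.
    by rewrite sumr_const card_ord -[_ *+ n]mulr_natr; field; rewrite gt_eqF.
  rewrite /tau expr_div_n sqr_sqrtr ?(ltW nR)// exprMn [leRHS]mulrAC.
  rewrite ler_wpM2l ?divr_ge0 ?sqr_ge0 ?(ltW nR)//.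
  exact: sum_sqr_row_le.
rewrite /expected_error /=.
pose M (z : noise) : R := \big[Num.max/0]_(c < k) `|noise_dot (b c) z|.
have mM : measurable_fun [set: noise] M.
  by apply: measurable_bigmax => c; apply: measurableT_comp => //; exact: measurable_noise_dot.
have M0 z : 0 <= M z by exact: bigmax_ge_id.
pose err z := linf_norm (alg_output gauss_alg G tt z - W *m cbdd s G).
have merr : measurable_fun [set: noise] err.
  apply: measurable_bigmax => c; apply: measurableT_comp => //.
  rewrite (_ : (fun _ => _) = fun z : noise => (L *m A *m cbdd s G) c ord0
    + noise_dot (b c) z - (W *m cbdd s G) c ord0); last first.
    by apply/funext => z; rewrite mxE [X in _ + X]mxE alg_outputE.
  apply: measurable_funB => //; apply: measurable_funD => //.
  exact: measurable_noise_dot.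
have errM z : err z <= eta + M z.
  apply: bigmax_le => [|c _]; first by rewrite addr_ge0.
  rewrite mxE [X in _ + X]mxE alg_outputE//.
  (* The bias is at most [eta], because [cbdd s G] is nonnegative with total mass at most 1 and the
     entries of [L *m A - W] are at most [eta] in absolute value. *)
  rewrite (_ : _ + _ + _ = ((L *m A - W) *m cbdd s G) c ord0 + noise_dot (b c) z); last first.
    by rewrite mulmxBl [in RHS]mxE [X in _ = _ + X + _]mxE; ring.
  apply: le_trans (ler_normD _ _) _; rewrite lerD//; last first.
    exact: (le_bigmax _ (fun c => `|noise_dot (b c) z|)).
  rewrite mxE; apply: le_trans (ler_norm_sum _ _ _) _.
  apply: (@le_trans _ _ (\sum_j eta * cbdd s G j ord0)).
    apply: ler_sum => j _; rewrite normrM (ger0_norm (cbdd_ge0 _ _ _ s0)).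
    by rewrite ler_wpM2r ?cbdd_ge0// (le_trans (norm_1_inf_ge _ _ _)).
  rewrite -mulr_sumr -[leRHS]mulr1 ler_wpM2l//.
  exact: sum_cbdd_le1.
have mEM : measurable_fun [set: noise] (fun z => (M z)%:E) by exact/measurable_EFinP.
have etaE : (0 <= eta%:E)%E by rewrite lee_fin.
have inner : (\int[gauss_noise n l]_z (err z)%:E <= (eta + 3 * tau * Num.sqrt (ln k%:R))%:E)%E.
  apply: (@le_trans _ _ (\int[gauss_noise n l]_z (eta%:E + (M z)%:E))%E).
    apply: ge0_le_integral => //.
    - by move=> z _; rewrite lee_fin; exact: bigmax_ge_id.
    - exact/measurable_EFinP.
    - by apply: emeasurable_funD.
    - by move=> z _; rewrite -EFinD lee_fin.
  rewrite ge0_integralD//; last by move=> z _; rewrite lee_fin.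
  rewrite integral_cst// [X in (_ * X + _)%E](probability_setT (gauss_noise n l)) mule1.
  rewrite EFinD leeD2l//; exact: integral_gauss_max_le.
rewrite (eq_integral (cst (\int[gauss_noise n l]_z (err z)%:E)%E)) => [|[]//].
by rewrite integral_cst// [X in (_ * X)%E](probability_setT (\d_tt : probability unit R)) mule1.
Qed.

End algorithm.

(** * The constant algorithm for vanishing factorization norm *)

Section zero_algorithm.
Context {R : realType} {n k : nat}.

Lemma zero_rand_meas (i : 'I_n) (N : {set 'I_n}) :
  measurable_fun [set: (unit * unit)%type] (fun z => (fun _ _ _ _ => tt) i z.1 N z.2).
Proof. exact: measurable_cst. Qed.

Lemma zero_post_meas (c : 'I_k) :
  measurable_fun [set: n.-tuple unit] (fun t => (fun _ => 0 : 'cV[R]_k) t c ord0).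
Proof. exact: measurable_cst. Qed.

(** Both sides are 1 if every event contains [tt], and 0 otherwise. *)
Lemma zero_indep (rho : unit) (N : 'I_n -> {set 'I_n}) :
  mutually_independent (\d_tt : probability unit R) (fun (_ : 'I_n) (_ : unit) => tt).
Proof.
move=> B mB; under eq_bigr do rewrite /= diracE.
rewrite /= diracE.
have [H|/existsNP [i Bi]] := pselect (forall i, B i tt).
  rewrite mem_set; last by move=> i _; exact: H.
  by rewrite big1// => i _; rewrite mem_set//; exact: H.
rewrite memNset => [|/(_ i I)//]; rewrite (bigD1 i)//= memNset ?mul0e//.
Qed.

Definition zero_alg : @local_alg R n k :=
  @LocalAlg R n k _ unit (\d_tt : probability unit R) _ unit (\d_tt : probability unit R)
    _ unit (fun _ _ _ _ => tt) (fun _ => 0) zero_rand_meas zero_post_meas zero_indep.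

Lemma zero_alg_LNDP (eps delta : R) : 0 <= eps -> 0 <= delta -> is_LNDP eps delta zero_alg.
Proof.
move=> e0 d0 rho G G' _ Y mY.
have E : rand_out zero_alg G rho = rand_out zero_alg G' rho by [].
have H (p : \bar R) : (0 <= p)%E -> (p <= (expR eps)%:E * p + delta%:E)%E.
  move=> p0; rewrite -[leLHS]adde0 leeD ?lee_fin//.
  by rewrite -[leLHS]mul1e lee_wpmul2r// lee_fin -expR0 ler_expR.
by rewrite E; split; apply: H; exact: measure_ge0.
Qed.

Lemma zero_alg_error (eta : R) s (W : 'M[R]_(k, nu n s)) (G : graph n) :
  (0 < s)%N -> 0 <= eta -> (forall i j, `|W i j| <= eta) ->
  (expected_error s zero_alg W G <= eta%:E)%E.
Proof.
move=> s0 eta0 HW; rewrite /expected_error /=.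
under eq_integral => rho _.
  rewrite integral_cst// [X in (_ * X)%E](probability_setT (\d_tt : probability unit R)) mule1.
  over.
rewrite integral_cst// [X in (_ * X)%E](probability_setT (\d_tt : probability unit R)) mule1.
rewrite lee_fin; apply: bigmax_le => // c _.
rewrite /alg_output /= sub0r mxE normrN mxE.
apply: le_trans (ler_norm_sum _ _ _) _.
apply: (@le_trans _ _ (\sum_j eta * cbdd s G j ord0)).
  apply: ler_sum => j _; rewrite normrM (ger0_norm (cbdd_ge0 _ _ _ s0)).
  by rewrite ler_wpM2r ?cbdd_ge0.
rewrite -mulr_sumr -[leRHS]mulr1 ler_wpM2l//.
exact: sum_cbdd_le1.
Qed.

End zero_algorithm.

Theorem theorem4p2 :
  exists C : nat, (0 < C)%N /\
  forall (R : realType) (eps delta : R) (n s k : nat) (eta : R)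
         (W : 'M[R]_(k, nu n s)),
    0 < eps < 1 -> 0 < delta <= 2^-1 ->
    (0 < n)%N -> (0 < s)%N -> (2 <= k)%N -> 0 <= eta ->
    exists A : @local_alg R n k,
      is_LNDP eps delta A /\
      forall G : graph n,
        (expected_error s A W G <=
         (C%:R * (eta + gamma_eta eta W *
            Num.sqrt ((n%:R^-1 + (s%:R ^+ 2)^-1) * ln k%:R) *
            (Num.sqrt (ln delta^-1) / eps)))%:E)%E.
Proof.
(* 24 is the product of 3 from the expected maximum, 4 from [sigma], and 2 from the near-optimal
   factorization. *)
exists 24%N; split => // R eps delta n s k eta W he hd n0 s0 k2 eta0.
have /andP[e0 e1] := he; have /andP[d0 d1] := hd.
have nR : 0 < n%:R :> R by rewrite ltr0n.
have sR : 0 < s%:R :> R by rewrite ltr0n.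
have lk := @half_le_ln_nat R k k2.
have lk0 : 0 < ln k%:R :> R by lra.
have ld := half_le_ln_inv delta hd.
have ld0 : 0 < ln delta^-1 by lra.
have g0 := gamma_eta_ge0 eta W eta0.
set g := gamma_eta eta W in g0 *.
set D : R := n%:R^-1 + (s%:R ^+ 2)^-1.
have D0 : 0 < D by rewrite addr_gt0 ?invr_gt0 ?exprn_gt0.
have [geq0|gn0] := eqVneq g 0.
  exists zero_alg; split; first by apply: zero_alg_LNDP; exact: ltW.
  move=> G; apply: (@le_trans _ _ eta%:E).
    apply: zero_alg_error => // i j.
    by have := normr_le_gamma_eta eta W eta0 i j; rewrite -/g geq0 addr0.
  by rewrite lee_fin geq0 !mul0r addr0 ler_peMl// ler1n.
have gg : 0 < g by rewrite lt_neqAle eq_sym gn0.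
(* The slack is [g] itself, so the product of the norms lies between [g] and [g + g]; the lower
   bound makes both norms positive. *)
have [l [L [A [LA /andP[gl lg]]]]] := gamma_eta_factorization eta W eta0 g gg.
have LA0 : 0 < norm_2_inf L * norm_1_2 A by exact: lt_le_trans gg gl.
have L0 : 0 < norm_2_inf L.
  rewrite lt_neqAle norm_2_inf_ge0 andbT eq_sym.
  by apply: contraTneq LA0 => ->; rewrite mul0r ltxx.
have A0 : 0 < norm_1_2 A.
  rewrite lt_neqAle norm_1_2_ge0 andbT eq_sym.
  by apply: contraTneq LA0 => ->; rewrite mulr0 ltxx.
pose q := Num.sqrt (ln delta^-1).
have qq : q ^+ 2 = ln delta^-1 by rewrite sqr_sqrtr// ltW.
have q0 : 0 < q by rewrite sqrtr_gt0.
pose r := Num.sqrt D.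
have rr : r ^+ 2 = D by rewrite sqr_sqrtr// ltW.
have r0 : 0 < r by rewrite sqrtr_gt0.
pose m := Num.sqrt (n%:R : R).
have mm : m ^+ 2 = n%:R by rewrite sqr_sqrtr// ltW.
have m0 : 0 < m by rewrite sqrtr_gt0.
(* As [n * (1/n + 1/s^2) = 1 + n/s^2], this value turns the privacy condition of [gauss_alg_LNDP]
   into an equality. Its factor [m] cancels the [Num.sqrt n%:R] gained by averaging. *)
pose sigma := 4 * norm_1_2 A * m * r * q / eps.
have sigma0 : 0 < sigma by rewrite divr_gt0// !mulr_gt0.
exists (gauss_alg L A sigma); split.
  apply: gauss_alg_LNDP => //.
  rewrite (_ : eps ^+ 2 * sigma ^+ 2 = 16 * norm_1_2 A ^+ 2 * m ^+ 2 * r ^+ 2 * q ^+ 2); last first.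
    by rewrite /sigma; field; rewrite gt_eqF.
  rewrite mm rr qq /D le_eqVlt; apply/orP; left; apply/eqP.
  by field; rewrite !gt_eqF.
move=> G; apply: le_trans (gauss_alg_error L A sigma eta W G n0 s0 k2 eta0 sigma0 L0 LA) _.
rewrite lee_fin sqrtrM ?(ltW D0)// -/q -/r -/m mulrDr lerD//.
  by rewrite ler_peMl// ler1n.
set t := Num.sqrt (ln k%:R).
have t0 : 0 <= t by exact: sqrtr_ge0.
rewrite (_ : 3 * _ * t = 12 * (r * t * q / eps) * (norm_2_inf L * norm_1_2 A)); last first.
  by rewrite /sigma; field; rewrite !gt_eqF.
rewrite (_ : 24%:R * _ = 12 * (r * t * q / eps) * (g + g)); last first.
  by field; rewrite gt_eqF.
rewrite ler_wpM2l ?(ltW lg)// !mulr_ge0 ?invr_ge0 ?(ltW r0) ?(ltW q0) ?(ltW e0)//.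
Qed.
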